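(* Let $R$ be any totally ordered semi-ring and let $q\geq 2$ be an integer. There is a constant $\epsilon>0$ such that for all sufficiently large $n$, if the cut polynomial $\mathrm{Cut}^q_n$ is a monotone affine projection of the permanent $\mathrm{perm}_m$ over $R$, then $m\geq 2^{\epsilon n}$. In particular, the family $(\mathrm{Cut}^q_n)_n$ is not a monotone affine p-projection of the family $(\mathrm{perm}_m)$.
   Context: A (commutative) totally ordered semi-ring is a totally ordered set $(R,\leq)$ with operations $\times,+$ and elements $1\neq 0$ such that $(R,\times,1)$, $(R,+,0)$ are commutative monoids, $\times$ distributes over $+$, $0\times a=0$, $a+c\leq b+c$ whenever $a\leq b$, and $ac\leq bc$ whenever $a\leq b$ and $0\leq c$. An element $c$ is non-negative if $0\leq c$. Polynomials are formal polynomials over $R$. The permanent is $\mathrm{perm}_m(Y)=\sum_{\pi\in S_m} y_{1,\pi(1)}\cdots y_{m,\pi(m)}$ in the $m^2$ variables $y_{ij}$. The $q$-th cut polynomial in variables $x_{ij}$ ($i,j\in[n]$, $i\neq j$) is $\mathrm{Cut}^q_n=\sum_{A\subseteq[n]}\prod_{i\in A,\, j\notin A} x_{ij}^{q-1}$. A polynomial $f(x_1,\dots,x_N)$ is a monotone affine projection of $g(y_1,\dots,y_M)$ if $f$ is obtained from $g$ by substituting for each $y_i$ an affine linear function $a_0+a_1x_1+\dots+a_Nx_N$ with all $a_k\in R$ non-negative. A family $(f_n)$ is a monotone affine p-projection of $(g_m)$ if there is a polynomially bounded $p$ with $f_n$ a monotone affine projection of $g_{p(n)}$ for all sufficiently large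 $n$. *)

(* Defs.v *)
From HB Require Import structures.
From mathcomp Require Import all_boot all_algebra perm finmap.

Set Implicit Arguments.
Unset Strict Implicit.
Unset Printing Implicit Defensive.

Import GRing.Theory.
Local Open Scope ring_scope.

(* The order is an explicit relation: the ordered structures of ssrnum all
   extend zmodType, and HB rejects a join of comNzSemiRingType and orderType
   outside that hierarchy.  Neither 0 <= 1 nor 0 <= a is required. *)
Record semiring_order (R : comNzSemiRingType) (le : rel R) : Prop :=
  SemiRingOrder {
    sord_refl : reflexive le;
    sord_anti : antisymmetric le;
    sord_trans : transitive le;
    sord_total : total le;
    sord_add2r : forall a b c : R, le a b -> le (a + c) (b + c);
    sord_mul2r : forall a b c : R, le a b -> le 0 c -> le (a * c) (b * c)
  }.

(* Polynomials over a semi-ring: the multinomials library requires the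
   coefficients to form a ring, so the monoid algebra of the exponent vectors
   {ffun I -> nat} is built here from finitely supported functions. *)
Record spoly (I : finType) (R : nzSemiRingType) : predArgType :=
  SPoly { spoly_val : {fsfun {ffun I -> nat} -> R with 0} }.

Section SPoly.
Context (I : finType) (R : nzSemiRingType).
Implicit Types (p : spoly I R) (k m : {ffun I -> nat}) (c : R).

HB.instance Definition _ := [isNew for @spoly_val I R].
HB.instance Definition _ := [Choice of spoly I R by <:].

Definition scoef p m : R := spoly_val p m.
Definition ssupp p : {fset {ffun I -> nat}} := finsupp (spoly_val p).
Definition smono c m : spoly I R := SPoly [fsfun k in [fset m]%fset => c].

Definition spoly0 : spoly I R := SPoly [fsfun].
Definition spolyD p q : spoly I R :=
  SPoly [fsfun m in (ssupp p `|` ssupp q)%fset => scoef p m + scoef q m].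

Lemma spolyP p q : (forall m, scoef p m = scoef q m) <-> p = q.
Proof. by case: p q => [p] [q]; split=> [h|->//]; congr SPoly; apply/fsfunP. Qed.

Lemma scoef_out p m : m \notin ssupp p -> scoef p m = 0.
Proof. exact: fsfun_dflt. Qed.

Lemma mem_ssupp p m : (m \in ssupp p) = (scoef p m != 0).
Proof. exact: mem_finsupp. Qed.

Lemma scoef_mono c m k : scoef (smono c m) k = if k == m then c else 0.
Proof. by rewrite /scoef fsfunE in_fset1. Qed.

Lemma scoef0_subproof m : scoef spoly0 m = 0.
Proof. by rewrite /scoef fsfunE. Qed.

Lemma scoefD_subproof p q m : scoef (spolyD p q) m = scoef p m + scoef q m.
Proof.
rewrite {1}/scoef fsfunE in_fsetU; case: ifP => // /norP[].
by move=> /scoef_out-> /scoef_out->; rewrite addr0.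
Qed.

Fact spolyDA : associative spolyD.
Proof. by move=> p q r; apply/spolyP=> m; rewrite !scoefD_subproof addrA. Qed.

Fact spolyDC : commutative spolyD.
Proof. by move=> p q; apply/spolyP=> m; rewrite !scoefD_subproof addrC. Qed.

Fact spoly0D : left_id spoly0 spolyD.
Proof.
by move=> p; apply/spolyP=> m; rewrite scoefD_subproof scoef0_subproof add0r.
Qed.

HB.instance Definition _ :=
  GRing.isNmodule.Build (spoly I R) spolyDA spolyDC spoly0D.

Lemma scoef0 m : scoef 0 m = 0.
Proof. exact: scoef0_subproof. Qed.

Lemma scoefD p q m : scoef (p + q) m = scoef p m + scoef q m.
Proof. exact: scoefD_subproof. Qed.

Lemma scoef_sum (T : Type) (r : seq T) (P : pred T) (F : T -> spoly I R) m :
  scoef (\sum_(i <- r | P i) F i) m = \sum_(i <- r | P i) scoef (F i) m.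
Proof.
apply: (big_morph (scoef^~ m)) => [p q|]; [exact: scoefD | exact: scoef0].
Qed.

Definition spoly1 : spoly I R := smono 1 0.

Definition spolyM p q : spoly I R :=
  \sum_(k <- ssupp p) \sum_(m <- ssupp q) smono (scoef p k * scoef q m) (k + m).

Lemma smono0 m : smono 0 m = 0.
Proof. by apply/spolyP=> k; rewrite scoef_mono scoef0 if_same. Qed.

Lemma smonoD c c' m : smono (c + c') m = smono c m + smono c' m.
Proof.
by apply/spolyP=> k; rewrite scoefD !scoef_mono; case: eqP; rewrite ?addr0.
Qed.

Lemma ssuppD p q : (ssupp (p + q)%R `<=` ssupp p `|` ssupp q)%fset.
Proof.
apply/fsubsetP=> m; apply: contraLR; rewrite in_fsetU => /norP[pm qm].
by rewrite mem_ssupp scoefD !scoef_out ?addr0 ?eqxx.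
Qed.

Lemma ssupp_mono c m : (ssupp (smono c m) `<=` [fset m])%fset.
Proof.
apply/fsubsetP=> k; rewrite mem_ssupp scoef_mono in_fset1.
by case: (k == m); rewrite ?eqxx.
Qed.

Lemma spolyE p : p = \sum_(m <- ssupp p) smono (scoef p m) m.
Proof.
apply/spolyP=> k; rewrite scoef_sum; case: (boolP (k \in ssupp p)) => kp.
  rewrite (big_fsetD1 k) //= scoef_mono eqxx big_seq big1 ?addr0 // => m.
  by rewrite in_fsetD1 scoef_mono eq_sym => /andP[/negPf->].
rewrite scoef_out // big_seq big1 // => m mp; rewrite scoef_mono.
by case: eqP => // km; rewrite km mp in kp.
Qed.

Lemma spoly_ind (P : spoly I R -> Prop) :
  P 0 -> (forall p q, P p -> P q -> P (p + q)) -> (forall c m, P (smono c m)) ->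
  forall p, P p.
Proof.
by move=> P0 PD Pm p; rewrite (spolyE p); elim/big_ind: _ => // m _; apply: Pm.
Qed.

Lemma spolyM_incl (A B : {fset {ffun I -> nat}}) p q :
  (ssupp p `<=` A)%fset -> (ssupp q `<=` B)%fset ->
  spolyM p q = \sum_(k <- A) \sum_(m <- B) smono (scoef p k * scoef q m) (k + m).
Proof.
move=> pA qB; rewrite /spolyM (big_fset_incl _ pA) /=.
  apply/eq_bigr=> k _; apply/big_fset_incl => // m _ /scoef_out->.
  by rewrite mulr0 smono0.
by move=> k _ /scoef_out pk; rewrite big1 // => m _; rewrite pk mul0r smono0.
Qed.

Lemma spolyM_mono c c' k m :
  spolyM (smono c k) (smono c' m) = smono (c * c') (k + m).
Proof.
rewrite (spolyM_incl (ssupp_mono _ _) (ssupp_mono _ _)) !big_seq_fset1.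
by rewrite !scoef_mono !eqxx.
Qed.

Fact spoly0M : left_zero 0 spolyM.
Proof.
move=> p; rewrite /spolyM big_seq big1 // => k.
by rewrite mem_ssupp scoef0 eqxx.
Qed.

Fact spolyM0 : right_zero 0 spolyM.
Proof.
move=> p; rewrite /spolyM big1 // => k _; rewrite big_seq big1 // => m.
by rewrite mem_ssupp scoef0 eqxx.
Qed.

Fact spolyMDl : left_distributive spolyM +%R.
Proof.
move=> p q r.
rewrite (spolyM_incl (ssuppD p q) (fsubset_refl (ssupp r))).
rewrite (spolyM_incl (fsubsetUl _ (ssupp q)) (fsubset_refl (ssupp r))).
rewrite (spolyM_incl (fsubsetUr (ssupp p) _) (fsubset_refl (ssupp r))).
rewrite -big_split /=; apply/eq_bigr=> k _.
rewrite -big_split /=; apply/eq_bigr=> m _.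
by rewrite scoefD mulrDl smonoD.
Qed.

Fact spolyMDr : right_distributive spolyM +%R.
Proof.
move=> r p q.
rewrite (spolyM_incl (fsubset_refl (ssupp r)) (ssuppD p q)).
rewrite (spolyM_incl (fsubset_refl (ssupp r)) (fsubsetUl _ (ssupp q))).
rewrite (spolyM_incl (fsubset_refl (ssupp r)) (fsubsetUr (ssupp p) _)).
rewrite -big_split /=; apply/eq_bigr=> k _.
rewrite -big_split /=; apply/eq_bigr=> m _.
by rewrite scoefD mulrDr smonoD.
Qed.

Fact spolyMA : associative spolyM.
Proof.
move=> p q r; elim/spoly_ind: p => [|p p' IH IH'|c k].
- by rewrite !spoly0M.
- by rewrite !spolyMDl IH IH'.
elim/spoly_ind: q => [|q q' IH IH'|c' m].
- by rewrite !(spoly0M, spolyM0).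
- by rewrite !(spolyMDl, spolyMDr) IH IH'.
elim/spoly_ind: r => [|r r' IH IH'|c'' n].
- by rewrite !spolyM0.
- by rewrite !spolyMDr IH IH'.
by rewrite !spolyM_mono mulrA addrA.
Qed.

Fact spoly1M : left_id spoly1 spolyM.
Proof.
elim/spoly_ind=> [|p q IH IH'|c m]; first exact: spolyM0.
  by rewrite spolyMDr IH IH'.
by rewrite spolyM_mono mul1r add0r.
Qed.

Fact spolyM1 : right_id spoly1 spolyM.
Proof.
elim/spoly_ind=> [|p q IH IH'|c m]; first exact: spoly0M.
  by rewrite spolyMDl IH IH'.
by rewrite spolyM_mono mulr1 addr0.
Qed.

Fact spoly1_neq0 : spoly1 != 0.
Proof.
by apply/eqP=> /spolyP/(_ 0)/eqP; rewrite scoef_mono eqxx scoef0 oner_eq0.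
Qed.

HB.instance Definition _ := GRing.Nmodule_isNzSemiRing.Build (spoly I R)
  spolyMA spoly1M spolyM1 spolyMDl spolyMDr spoly0M spolyM0 spoly1_neq0.

Definition sconst c : spoly I R := smono c 0.
Definition svar (i : I) : spoly I R := smono 1 [ffun j => (j == i) : nat].

End SPoly.

Section SPolyCom.
Context (I : finType) (R : comNzSemiRingType).

Fact spolyMC : commutative (@spolyM I R).
Proof.
move=> p q; rewrite /spolyM exchange_big /=.
by apply/eq_bigr=> m _; apply/eq_bigr=> k _; rewrite mulrC addrC.
Qed.

HB.instance Definition _ :=
  GRing.PzSemiRing_hasCommutativeMul.Build (spoly I R) spolyMC.

End SPolyCom.

Definition ssubst (I J : finType) (R : comNzSemiRingType)
    (g : spoly J R) (h : J -> spoly I R) : spoly I R :=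
  \sum_(m <- ssupp g) sconst I (scoef g m) * \prod_j h j ^+ m j.

Definition affine (I : finType) (R : comNzSemiRingType) (a0 : R) (a : I -> R) :
  spoly I R := sconst I a0 + \sum_i sconst I (a i) * svar R i.

Definition monotone_affine_projection (R : comNzSemiRingType)
    (le : rel R) (I J : finType)
    (f : spoly I R) (g : spoly J R) : Prop :=
  exists (a0 : J -> R) (a : J -> I -> R),
    [/\ forall j, le 0 (a0 j),
        forall j i, le 0 (a j i)
      & f = ssubst g (fun j => affine (a0 j) (a j))].

Definition polynomially_bounded (p : nat -> nat) : Prop :=
  exists c : nat, forall n : nat, (p n <= n ^ c + c)%N.

Definition monotone_affine_p_projection (R : comNzSemiRingType)
    (le : rel R) (I J : nat -> finType)
    (f : forall n, spoly (I n) R) (g : forall m, spoly (J m) R) : Prop :=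
  exists2 p : nat -> nat, polynomially_bounded p &
    exists n0 : nat, forall n : nat, (n0 <= n)%N ->
      monotone_affine_projection le (f n) (g (p n)).

Definition perm_poly (R : comNzSemiRingType) (m : nat) :
    spoly ('I_m * 'I_m)%type R :=
  \sum_(s : 'S_m) \prod_(i < m) svar R (i, s i).

Definition offdiag (n : nat) : finType :=
  {ij : 'I_n * 'I_n | ij.1 != ij.2}.

Definition cut_poly (R : comNzSemiRingType) (q n : nat) :
    spoly (offdiag n) R :=
  \sum_(A : {set 'I_n})
    \prod_(ij : offdiag n | ((val ij).1 \in A) && ((val ij).2 \notin A))
      svar R ij ^+ q.-1.

(* Main.v *)
Require Import Defs.
From mathcomp Require Import all_boot all_order all_algebra reals exp.
From mathcomp Require Import perm finmap boolp zify ring.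

(* A non-negative element is sent to whether it is not nilpotent; this is a
   homomorphism from the non-negative cone to the Boolean semi-ring, so a
   projection of [perm_m] expands into labelled perfect matchings of K_{m,m}
   (a label being a variable or the constant term) whose monomials are exactly
   those of the cut polynomial.  The linear functional with value
   (q-1)(1-(1-|a :&: b|)^2) at the cut of a, and at most q-1 at every cut, turns
   the m^2 (number of labels) edges into a covering by rectangles of the pairs
   with a, b disjoint that avoids the pairs with |a :&: b| = 1; this is the
   combinatorial form of "the permanent polytope is an extension of the cut
   polytope", the duality for matchings being replaced by Hall's theorem.  Of
   the 3^(n-1) disjoint pairs one rectangle covers at most 2^(n-1) (Kaibel and
   Weltge), hence m^2 n^2 >= (3/2)^(n-1). *)

Set Implicit Arguments.
Unset Strict Implicit.
Unset Printing Implicit Defensive.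

Import GRing.Theory Num.Theory.
Local Open Scope ring_scope.

(** * Hall's theorem and regular bipartite multigraphs *)

(** In an inclusion-minimal edge set satisfying Hall's condition every vertex of [T] has exactly one
    edge; the condition on pairs makes the resulting function injective. *)
Lemma hall (T T' : finType) (r : T -> T' -> bool) :
  (forall X : {set T}, #|X| <= #|[set y | [exists x in X, r x y]]|)%N ->
  exists2 f : T -> T', injective f & forall x, r x (f x).
Proof.
move=> hr.
pose nb (E : {set T * T'}) (X : {set T}) :=
  [set y | [exists x in X, (x, y) \in E]].
pose hallE E := [forall X : {set T}, #|X| <= #|nb E X|]%N.
have nbP (E : {set T * T'}) (X : {set T}) y :
    reflect (exists2 x, x \in X & (x, y) \in E) (y \in nb E X).
  by rewrite inE; apply: exists_inP.
have h0 : hallE [set p | r p.1 p.2].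
  apply/forallP=> X; apply: leq_trans (hr X) _; apply: subset_leq_card.
  apply/subsetP=> y; rewrite inE => /exists_inP[x xX rxy]; apply/nbP.
  by exists x; rewrite ?inE.
have [E /minsetP[hE minE] /subsetP sE] := minset_exists h0.
(* A set violating the condition once (x, y) is deleted must contain x, as its neighbourhood would
   otherwise be unchanged. *)
have crit x y : (x, y) \in E ->
    exists2 X : {set T}, x \in X & (#|nb (E :\ (x, y)) X| < #|X|)%N.
  move=> xyE.
  have /forallPn[X] : ~~ hallE (E :\ (x, y)).
    apply/negP=> /minE/(_ (subsetDl _ _)) e.
    by move: xyE; rewrite -e !inE eqxx.
  rewrite -ltnNge => ltX; exists X => //; apply: contraLR ltX => xX.
  rewrite -leqNgt; move/forallP: hE => /(_ X) hX; apply: leq_trans hX _.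
  apply: subset_leq_card; apply/subsetP=> z /nbP[t tX tzE]; apply/nbP.
  exists t => //; rewrite !inE tzE andbT; apply: contraNneq xX => -[<- _] //.
(* Submodularity: by [leU] and [leI] the two reduced neighbourhoods have total size at least |X1| +
   |X2| - 1, while criticality gives at most |X1| + |X2| - 2. *)
have uni x y1 y2 : (x, y1) \in E -> (x, y2) \in E -> y1 = y2.
  move=> E1 E2; apply/eqP/negPn/negP=> y12.
  have [X1 x1 lt1] := crit _ _ E1; have [X2 x2 lt2] := crit _ _ E2.
  move/forallP: hE => hE.
  have leU : (#|X1 :|: X2| <= #|nb (E :\ (x, y1)) X1 :|: nb (E :\ (x, y2)) X2|)%N.
    apply: leq_trans (hE _) _; apply: subset_leq_card.
    apply/subsetP=> z /nbP[t tX tzE]; rewrite inE; apply/orP.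
    have [e|ne] := eqVneq (t, z) (x, y1).
      right; apply/nbP; exists x => //; case: e => _ ->.
      by rewrite !inE E1 andbT; apply: contraNneq y12 => -[->].
    have [e|ne2] := eqVneq (t, z) (x, y2).
      left; apply/nbP; exists x => //; case: e => _ ->.
      by rewrite !inE E2 andbT; apply: contraNneq y12 => -[->].
    by move: tX; rewrite inE => /orP[] tX; [left|right]; apply/nbP;
      exists t; rewrite // !inE tzE ?ne ?ne2.
  have leI : (#|(X1 :&: X2) :\ x| <=
      #|nb (E :\ (x, y1)) X1 :&: nb (E :\ (x, y2)) X2|)%N.
    apply: leq_trans (hE _) _; apply: subset_leq_card.
    apply/subsetP=> z /nbP[t]; rewrite in_setD1 !in_setI => /and3P[tx tX1 tX2] tzE.
    by apply/andP; split; apply/nbP; exists t; rewrite // !inE tzE xpair_eqE (negPf tx).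
  have xI : x \in X1 :&: X2 by rewrite inE x1.
  have := cardsUI X1 X2.
  have := cardsUI (nb (E :\ (x, y1)) X1) (nb (E :\ (x, y2)) X2).
  have := cardsD1 x (X1 :&: X2); rewrite xI; lia.
move/forallP: hE => hE.
have ex x : exists y, (x, y) \in E.
  have := hE [set x]; rewrite cards1 => /card_gt0P[y /nbP[z]].
  by rewrite inE => /eqP-> xyE; exists y.
exists (fun x => xchoose (ex x)) => [x1 x2 e|x]; last first.
  by have := sE _ (xchooseP (ex x)); rewrite inE.
apply/eqP/negPn/negP=> x12.
have := hE [set x1; x2]; rewrite cards2 x12 leqNgt => /negP; apply.
rewrite ltnS -[X in (_ <= X)%N]/1%N -(cards1 (xchoose (ex x1))); apply: subset_leq_card.
apply/subsetP=> y /nbP[x]; rewrite !inE => /orP[]/eqP-> xyE; apply/eqP.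
  exact: uni xyE (xchooseP (ex x1)).
by rewrite e; exact: uni xyE (xchooseP (ex x2)).
Qed.

(** Double counting gives Hall's condition: the k|X| edges leaving X all enter its neighbourhood
    [Y], which receives k|Y|. *)
Lemma regular_matching (T : finType) (k : nat) (D : T -> T -> nat) :
  (0 < k)%N -> (forall i, \sum_j D i j = k)%N -> (forall j, \sum_i D i j = k)%N ->
  exists s : {perm T}, forall i, (0 < D i (s i))%N.
Proof.
move=> k0 rowD colD.
have [|f injf Df] := @hall T T (fun i j => (0 < D i j)%N).
  move=> X; rewrite -(leq_pmul2r k0) -!sum_nat_const.
  set Y := [set y | _].
  rewrite -(eq_bigr _ (fun i _ => rowD i)) -(eq_bigr _ (fun i _ => colD i)).
  rewrite exchange_big /= (bigID (mem Y)) /= [X in (_ + X)%N]big1 ?addn0.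
    apply: leq_sum => j _; rewrite [leqRHS](bigID (mem X)) /=; exact: leq_addr.
  move=> j jY; apply: big1 => i iX; apply/eqP; rewrite eqn0Ngt.
  by apply: contraNN jY => Dij; rewrite inE; apply/exists_inP; exists i.
by exists (perm injf) => i; rewrite permE.
Qed.

Definition edge (T U : finType) (s : {perm T}) (c : {ffun T -> U})
  (i j : T) (u : U) : bool := (j == s i) && (u == c i).

Section EdgeSums.
Context (T U : finType) (s : {perm T}) (c : {ffun T -> U}).

Lemma edge_row (i : T) : (\sum_j \sum_u edge s c i j u = 1)%N.
Proof.
rewrite (bigD1 (s i)) //= (bigD1 (c i)) //= /edge !eqxx !big1 //.
  by move=> j /negPf->; rewrite big1.
by move=> u /negPf->.
Qed.

Lemma edge_col (j : T) : (\sum_i \sum_u edge s c i j u = 1)%N.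
Proof.
rewrite (bigD1 ((s^-1)%g j)) //= (bigD1 (c ((s^-1)%g j))) //= /edge permKV !eqxx.
rewrite !big1 //; last by move=> u /negPf->.
move=> i ij; rewrite big1 // => u _.
by case: eqP => //= jE; rewrite jE permK eqxx in ij.
Qed.

Lemma edge_weight (w : U -> int) :
  \sum_i \sum_j \sum_u (edge s c i j u : nat)%:Z * w u = \sum_i w (c i).
Proof.
apply: eq_bigr => i _.
rewrite (bigD1 (s i)) //= (bigD1 (c i)) //= /edge !eqxx mul1r !big1 ?addr0 //.
  by move=> j /negPf->; rewrite big1 // => u _; rewrite mul0r.
by move=> u /negPf->; rewrite mul0r.
Qed.

End EdgeSums.

(** Induction on k: peeling off a perfect matching of weight at most W leaves a (k-1)-regular
    multigraph whose matchings still lie in D. *)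
Lemma regular_weight (T U : finType) (k : nat) (D : T -> T -> U -> nat)
    (w : U -> int) (W : int) :
  (forall i, \sum_j \sum_u D i j u = k)%N ->
  (forall j, \sum_i \sum_u D i j u = k)%N ->
  (forall (s : {perm T}) (c : {ffun T -> U}),
     (forall i, 0 < D i (s i) (c i))%N -> \sum_i w (c i) <= W) ->
  \sum_i \sum_j \sum_u (D i j u)%:Z * w u <= k%:Z * W.
Proof.
elim: k D => [|k IH] D rowD colD hW.
  rewrite mul0r big1 // => i _; rewrite big1 // => j _; rewrite big1 // => u _.
  move: (rowD i) => /eqP; rewrite sum_nat_eq0 => /forallP/(_ j)/=.
  by rewrite sum_nat_eq0 => /forallP/(_ u)/eqP ->; rewrite mul0r.
have [s sD] := regular_matching (ltn0Sn k) rowD colD.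
have ex i : exists u, (0 < D i (s i) u)%N.
  have := sD i; rewrite lt0n sum_nat_eq0 => /forallPn[u]; rewrite /= -lt0n.
  by exists u.
pose c := [ffun i => xchoose (ex i)].
have cD i : (0 < D i (s i) (c i))%N by rewrite ffunE; exact: (xchooseP (ex i)).
have DE i j u : D i j u = (D i j u - edge s c i j u + edge s c i j u)%N.
  by rewrite subnK // /edge; case: eqP => //= ->; case: eqP => //= ->.
have -> : \sum_i \sum_j \sum_u (D i j u)%:Z * w u =
    \sum_i \sum_j \sum_u (D i j u - edge s c i j u)%N%:Z * w u + \sum_i w (c i).
  rewrite -(edge_weight s) -big_split /=; apply: eq_bigr => i _.
  rewrite -big_split /=; apply: eq_bigr => j _.
  rewrite -big_split /=; apply: eq_bigr => u _.
  by rewrite -mulrDl -PoszD -DE.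
rewrite -addn1 PoszD mulrDl mul1r lerD //; last exact: hW.
apply: IH => [i|j|s' c' D'].
- apply/(@addIn (\sum_j \sum_u edge s c i j u)%N).
  rewrite [in RHS]edge_row addn1 -(rowD i) -big_split /=.
  by apply: eq_bigr => j _; rewrite -big_split /=; apply: eq_bigr => u _; rewrite -DE.
- apply/(@addIn (\sum_i \sum_u edge s c i j u)%N).
  rewrite [in RHS]edge_col addn1 -(colD j) -big_split /=.
  by apply: eq_bigr => i _; rewrite -big_split /=; apply: eq_bigr => u _; rewrite -DE.
by apply: hW => i; apply: leq_trans (D' i) (leq_subr _ _).
Qed.

(** * Disjoint pairs and rectangles *)

Fixpoint disjoint_pairs (n : nat) : seq (bitseq * bitseq) :=
  if n is n'.+1 then
    let s := disjoint_pairs n' in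
    [seq (false :: p.1, false :: p.2) | p <- s] ++
    [seq (true :: p.1, false :: p.2) | p <- s] ++
    [seq (false :: p.1, true :: p.2) | p <- s]
  else [:: ([::], [::])].

Definition isect (n : nat) (a b : bitseq) : nat :=
  (\sum_(i < n) (nth false a i && nth false b i))%N.

Lemma isect_cons n x y a b : isect n.+1 (x :: a) (y :: b) = ((x && y) + isect n a b)%N.
Proof. by rewrite /isect big_ord_recl. Qed.

Lemma size_disjoint_pairs n : size (disjoint_pairs n) = (3 ^ n)%N.
Proof. by elim: n => //= n IH; rewrite !size_cat !size_map IH expnS; lia. Qed.

Lemma disjoint_pairs_isect n p : p \in disjoint_pairs n -> isect n p.1 p.2 = 0%N.
Proof.
elim: n p => [|n IH] p /=; first by rewrite /isect big_ord0.
by rewrite !mem_cat => /or3P[]/mapP[p' /IH e ->]; rewrite isect_cons.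
Qed.

(* Kaibel and Weltge: above a disjoint pair (a, b) of length n, the pairs
   (1a, 0b) and (0a, 1b) cannot both lie in the rectangle, since (1a, 1b) would;
   so the pairs above (a, b) are at most as many as the two projected
   rectangles that contain (a, b). *)
Lemma rectangle_disjoint_pairs n (P Q : pred bitseq) :
  (forall a b, P a -> Q b -> isect n a b != 1%N) ->
  (count [pred p | P p.1 && Q p.2] (disjoint_pairs n) <= 2 ^ n)%N.
Proof.
elim: n P Q => [|n IH] P Q hPQ /=; first by case: (P _ && Q _).
rewrite !count_cat !count_map.
pose P0 a := P (false :: a); pose P1 a := P (true :: a).
pose Q0 a := Q (false :: a); pose Q1 a := Q (true :: a).
have IH1 := IH [pred a | P0 a || P1 a] Q0.
have IH2 := IH P0 [pred b | Q0 b || Q1 b].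
rewrite expnS mul2n -addnn; apply: leq_trans (leq_add (IH1 _) (IH2 _)); first last.
- by move=> a b Pa /= /orP[] /(hPQ _ _ Pa); rewrite isect_cons.
- move=> a b /= /orP[] /hPQ h Qb; have := h _ Qb; by rewrite isect_cons ?andbF.
rewrite -!sumn_count !sumnE !big_map -!big_split /= big_seq [leqRHS]big_seq.
apply: leq_sum => -[a b] /disjoint_pairs_isect/= ab.
have := hPQ (true :: a) (true :: b); rewrite isect_cons ab eqxx /=.
rewrite -/(P1 a) -/(Q1 b) -/(P0 a) -/(Q0 b).
by case: (P0 a) (P1 a) (Q0 b) (Q1 b) => [] [] [] [] //= /(_ isT isT).
Qed.

(** Double counting: every disjoint pair lies in some rectangle, and each rectangle holds at most
    2^n of them. *)
Lemma rectangle_cover n (E : finType) (P Q : E -> pred bitseq) :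
  (forall e a b, P e a -> Q e b -> isect n a b != 1%N) ->
  (forall a b, isect n a b = 0%N -> exists2 e, P e a & Q e b) ->
  (3 ^ n <= #|E| * 2 ^ n)%N.
Proof.
move=> hPQ cov; rewrite -size_disjoint_pairs -sum1_size -sum_nat_const.
apply: (@leq_trans (\sum_e count [pred p | P e p.1 && Q e p.2] (disjoint_pairs n))).
  under [leqRHS]eq_bigr => e _ do rewrite -sumn_count sumnE big_map.
  rewrite exchange_big /= big_seq [leqRHS]big_seq; apply: leq_sum => p.
  move=> /disjoint_pairs_isect/cov[e Pe Qe].
  by rewrite (bigD1 e) //= Pe Qe.
by apply: leq_sum => e _; apply: rectangle_disjoint_pairs; exact: hPQ.
Qed.

(** * Exponential estimates *)

Lemma exp2_le_of_cover (n m : nat) : (34 <= n)%N ->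
  (3 ^ n.-1 <= m * m * (n * n) * 2 ^ n.-1)%N -> (2 ^ n <= m ^ 16)%N.
Proof.
case: n => // n n34 /= h.
(* Eighth powers let 3^2 >= 2^3 turn 3^(8n) into 2^(12n); here n is the predecessor of the original
   one. *)
have h8 : (2 ^ (12 * n) <= m ^ 16 * n.+1 ^ 16 * 2 ^ (8 * n))%N.
  rewrite (_ : 12 * n = 3 * (4 * n))%N; last lia.
  apply: (@leq_trans (3 ^ (2 * (4 * n)))); first by rewrite !expnM leq_exp2r //; lia.
  have : ((3 ^ n) ^ 8 <= (m * m * (n.+1 * n.+1) * 2 ^ n) ^ 8)%N by rewrite leq_exp2r.
  have sq x : ((x * x) ^ 8 = x ^ 16)%N by rewrite mulnn -expnM.
  rewrite expnMn [in leqRHS]expnMn !sq -!expnM (mulnC n).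
  by rewrite (_ : 2 * (4 * n) = 8 * n)%N; last lia.
(* Writing n+1 = 16y + z with z < 16, the bound y < 2^y gives n+1 <= 16 2^y. *)
have hn : (n.+1 ^ 16 <= 2 ^ (64 + n.+1))%N.
  have : (n.+1 <= 2 ^ 4 * 2 ^ (n.+1 %/ 16))%N.
    rewrite {1}(divn_eq n.+1 16).
    have := ltn_expl (n.+1 %/ 16) (isT : 1 < 2)%N.
    have := ltn_pmod n.+1 (isT : 0 < 16)%N.
    rewrite (_ : 2 ^ 4 = 16)%N; last exact: erefl.
    move: (_ %/ _)%N (_ %% _)%N => y z; move: (2 ^ _)%N => x; clear -x y z; lia.
  rewrite -(@leq_exp2r _ _ 16) // => /leq_trans; apply.
  rewrite -expnD -expnM leq_exp2l // mulnDl leq_add2l; exact: leq_trunc_div.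
(* This amounts to n >= 33, which is the source of the threshold 34. *)
have e : (n.+1 + (64 + n.+1 + 8 * n) <= 12 * n)%N by clear -n34; lia.
have pos : (0 < 2 ^ (64 + n.+1 + 8 * n))%N by rewrite expn_gt0.
rewrite -(leq_pmul2r pos) -expnD.
move: (64 + n.+1)%N hn e {pos} => k hn e.
have lt12 : (1 < 2)%N by [].
apply: leq_trans (leq_trans h8 _); first by rewrite (leq_exp2l _ _ lt12).
by rewrite -mulnA leq_mul2l [leqRHS]expnD leq_mul2r hn !orbT.
Qed.

Lemma polynomially_bounded_lt_exp (c N : nat) :
  exists2 n : nat, (N <= n)%N & ((n ^ c + c) ^ 16 < 2 ^ n)%N.
Proof.
(* The left side is at most n^d = 2^(2jd), and 2jd < (2^j)^2 because both j and 2d are below 2^j. *)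
pose d := (16 * c.+2)%N; pose j := (N + 2 * d + c + 1)%N.
pose n := (2 ^ (2 * j))%N.
have jn : (2 * j < n)%N by exact: ltn_expl.
exists n; first by apply: leq_trans (ltnW jn); rewrite /j; lia.
have n2 : (2 <= n)%N by apply: leq_trans (ltnW jn); rewrite /j; lia.
have cn : (c <= n)%N by apply: leq_trans (ltnW jn); rewrite /j; lia.
have le1 : (n ^ c + c <= n ^ c.+2)%N.
  apply: (@leq_trans (n ^ c.+1 * 2)); last by rewrite [leqRHS]expnSr leq_mul2l n2 orbT.
  rewrite muln2 -addnn leq_add // ?leq_pexp2l //; try lia.
  by apply: leq_trans cn _; rewrite -[leqLHS]expn1 leq_pexp2l //; lia.
apply: (@leq_ltn_trans (n ^ d)); first by rewrite /d mulnC expnM leq_exp2r.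
rewrite /n -expnM ltn_exp2l // mul2n -addnn expnD.
have := ltn_expl j (isT : 1 < 2)%N; move: (2 ^ j)%N => x jx.
have : (2 * d < x)%N by apply: leq_trans jx; rewrite /j ltnS; lia.
by move: jx; clearbody j d; clear -j; nia.
Qed.

(** * Nilpotent elements of the non-negative cone *)

Definition nilpotent (R : comNzSemiRingType) (x : R) : Prop :=
  exists k : nat, x ^+ k = 0.

(* The nilpotent non-negative elements form a prime ideal of the non-negative
   cone, so [~ nilpotent] is a homomorphism from that cone to the Boolean
   semi-ring; this replaces the missing absence of zero divisors. *)
Section OrderedSemiring.
Context (R : comNzSemiRingType) (le : rel R) (hle : semiring_order le).
Implicit Types a b x y : R.

Let le_trans := sord_trans hle.

Lemma nonneg_add a b : le 0 a -> le 0 b -> le 0 (a + b).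
Proof.
move=> a0 b0; apply: le_trans b0 _.
by have := sord_add2r hle b a0; rewrite add0r.
Qed.

Lemma nonneg_mul a b : le 0 a -> le 0 b -> le 0 (a * b).
Proof. by move=> a0 b0; have := sord_mul2r hle a0 b0; rewrite mul0r. Qed.

Lemma le_eq0 a : le 0 a -> le a 0 -> a = 0.
Proof. by move=> a0 a0'; apply: (sord_anti hle); rewrite a0 a0'. Qed.

Lemma nonneg_sum (I : Type) (r : seq I) (P : pred I) (F : I -> R) :
  (forall i, P i -> le 0 (F i)) -> le 0 (\sum_(i <- r | P i) F i).
Proof.
by move=> F0; elim/big_ind: _ => //; [exact: sord_refl | exact: nonneg_add].
Qed.

Lemma nonneg_sum_eq0 (I : finType) (F : I -> R) :
  (forall i, le 0 (F i)) -> \sum_i F i = 0 -> forall i, F i = 0.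
Proof.
move=> F0 + i; rewrite (bigD1 i) //= addrC => s0; apply: le_eq0 => //.
have := sord_add2r hle (F i) (nonneg_sum (index_enum I) (fun j _ => F0 j)).
have := sord_add2r hle (F i)
  (nonneg_sum (index_enum I) (fun j (_ : j != i) => F0 j)).
by rewrite s0 add0r.
Qed.

Lemma nonneg_nat_ge1 (n : nat) : le 0 1 -> (0 < n)%N -> le 1 (n%:R : R).
Proof.
move=> h01; elim: n => // -[|n] IH _; first exact: sord_refl.
apply: le_trans (IH isT) _.
by have := sord_add2r hle n.+1%:R h01; rewrite add0r -mulrS.
Qed.

Hypothesis h01 : le 0 1.

Lemma nonneg_exp a k : le 0 a -> le 0 (a ^+ k).
Proof. by move=> a0; elim: k => // k IH; rewrite exprS; exact: nonneg_mul. Qed.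

Lemma le_exp a b k : le 0 a -> le a b -> le (a ^+ k) (b ^+ k).
Proof.
move=> a0 ab; elim: k => [|k IH]; first exact: sord_refl.
have b0 := le_trans a0 ab.
apply: (@le_trans (b * a ^+ k)); rewrite exprS.
  by apply: sord_mul2r => //; exact: nonneg_exp.
by rewrite ![b * _]mulrC; apply: sord_mul2r.
Qed.

Lemma nilpotent_le a b : le 0 a -> le a b -> nilpotent b -> nilpotent a.
Proof.
move=> a0 ab [k bk]; exists k; apply: le_eq0; first exact: nonneg_exp.
by rewrite -bk; exact: le_exp.
Qed.

Lemma nilpotentMr a b : nilpotent a -> nilpotent (a * b).
Proof. by case=> k ak; exists k; rewrite exprMn ak mul0r. Qed.

(** If a <= b, the sum is at most b + b, a multiple of the nilpotent b. *)
Lemma nilpotentD a b :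
  le 0 a -> le 0 b -> nilpotent a -> nilpotent b -> nilpotent (a + b).
Proof.
wlog ab : a b / le a b.
  by move=> wl a0 b0 na nb; case/orP: (sord_total hle a b) => ?;
    [|rewrite addrC]; apply: wl.
move=> a0 b0 na nb; apply: (@nilpotent_le _ (b + b)).
- exact: nonneg_add.
- exact: sord_add2r.
by rewrite -[b]mulr1 -mulrDr; exact: nilpotentMr.
Qed.

(** If a <= b, then a^2 <= ab, so a^2 and hence a is nilpotent. *)
Lemma nilpotent_prime a b :
  le 0 a -> le 0 b -> nilpotent (a * b) -> nilpotent a \/ nilpotent b.
Proof.
wlog ab : a b / le a b.
  move=> wl a0 b0 nab; case/orP: (sord_total hle a b) => ?; first exact: wl.
  by apply/or_comm; apply: wl => //; rewrite mulrC.
move=> a0 b0 nab; left.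
have [k] : nilpotent (a * a).
  apply: nilpotent_le nab; first exact: nonneg_mul.
  by rewrite [a * b]mulrC; apply: sord_mul2r.
by rewrite -expr2 -exprM => ak; exists (2 * k)%N.
Qed.

Lemma sum_not_nilpotent (I : finType) (F : I -> R) :
  (forall i, le 0 (F i)) -> ~ nilpotent (\sum_i F i) ->
  exists i, ~ nilpotent (F i).
Proof.
move=> F0 h; apply: contrapT => nF; apply: h.
suff [] : le 0 (\sum_i F i) /\ nilpotent (\sum_i F i) by [].
elim/big_ind: _ => [|x y [x0 nx] [y0 ny]|i _].
- by split; [exact: sord_refl | exists 1%N].
- by split; [exact: nonneg_add | exact: nilpotentD].
by split => //; apply: contrapT => nFi; apply: nF; exists i.
Qed.

Lemma prod_not_nilpotent (I : finType) (F : I -> R) :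
  (forall i, le 0 (F i)) -> (forall i, ~ nilpotent (F i)) ->
  ~ nilpotent (\prod_i F i).
Proof.
move=> F0 nF; suff [] : le 0 (\prod_i F i) /\ ~ nilpotent (\prod_i F i) by [].
elim/big_ind: _ => [|x y [x0 nx] [y0 ny]|i _].
- by split => // -[k]; rewrite expr1n => /eqP; rewrite oner_eq0.
- by split; [exact: nonneg_mul | move=> /(nilpotent_prime x0 y0)[]].
by split.
Qed.

Lemma not_nilpotent_ge1 a : le 1 a -> ~ nilpotent a.
Proof.
move=> a1 /(nilpotent_le h01 a1)[k]; rewrite expr1n => /eqP.
by rewrite oner_eq0.
Qed.

End OrderedSemiring.

(** * Expansion of a projected permanent *)

Section Monomials.
Context (I : finType) (R : comNzSemiRingType).
Implicit Types (k m : {ffun I -> nat}) (c : R).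

Lemma smonoM c c' k m :
  smono c k * smono c' m = smono (c * c') (k + m) :> spoly I R.
Proof. exact: spolyM_mono. Qed.

Lemma smono_prod (J : Type) (r : seq J) (P : pred J) (c : J -> R)
    (k : J -> {ffun I -> nat}) :
  \prod_(j <- r | P j) smono (c j) (k j) =
  smono (\prod_(j <- r | P j) c j) (\sum_(j <- r | P j) k j).
Proof. by elim/big_rec3: _ => // j x y z _ ->; rewrite smonoM. Qed.

Lemma svarX (i : I) n :
  svar R i ^+ n = smono 1 [ffun j => ((j == i) * n)%N].
Proof.
elim: n => [|n IH]; last rewrite exprS IH smonoM mulr1; congr smono;
  apply/ffunP => j; rewrite !ffunE ?muln0 // mulnS //.
Qed.

End Monomials.

Section Substitution.
Context (I J : finType) (R : comNzSemiRingType) (h : J -> spoly I R).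
Implicit Types g : spoly J R.

Lemma ssubst_incl (A : {fset {ffun J -> nat}}) g : (ssupp g `<=` A)%fset ->
  ssubst g h = \sum_(m <- A) sconst I (scoef g m) * \prod_j h j ^+ m j.
Proof.
move=> gA; rewrite /ssubst; apply/big_fset_incl => // m _ /scoef_out->.
by rewrite /sconst smono0 mul0r.
Qed.

Lemma ssubst0 : ssubst 0 h = 0.
Proof.
by rewrite /ssubst big_seq big1 // => m; rewrite mem_ssupp scoef0 eqxx.
Qed.

Lemma ssubstD g g' : ssubst (g + g') h = ssubst g h + ssubst g' h.
Proof.
rewrite (ssubst_incl (ssuppD g g')) (ssubst_incl (fsubsetUl _ (ssupp g'))).
rewrite (ssubst_incl (fsubsetUr (ssupp g) _)) -big_split /=.
by apply: eq_bigr => m _; rewrite scoefD /sconst smonoD mulrDl.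
Qed.

Lemma ssubst_sum (T : Type) (r : seq T) (F : T -> spoly J R) :
  ssubst (\sum_(t <- r) F t) h = \sum_(t <- r) ssubst (F t) h.
Proof.
by elim/big_rec2: _ => [|t x y _ <-]; [exact: ssubst0 | exact: ssubstD].
Qed.

Lemma ssubst_mono1 m : ssubst (smono 1 m) h = \prod_j h j ^+ m j.
Proof.
by rewrite (ssubst_incl (ssupp_mono _ _)) big_seq_fset1 scoef_mono eqxx mul1r.
Qed.

End Substitution.

Lemma ssubst_perm (I : finType) (R : comNzSemiRingType) (m : nat)
    (h : 'I_m * 'I_m -> spoly I R) :
  ssubst (perm_poly R m) h = \sum_(s : 'S_m) \prod_i h (i, s i).
Proof.
rewrite ssubst_sum; apply: eq_bigr => s _.
rewrite smono_prod big1_eq ssubst_mono1.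
rewrite [RHS](eq_bigr (fun i => \prod_j h (i, j) ^+ (j == s i))); last first.
  move=> i _; rewrite (bigD1 (s i)) //= eqxx expr1 big1 ?mulr1 //.
  by move=> j /negPf->.
rewrite pair_bigA; apply: eq_bigr => -[i j] _ /=; congr (_ ^+ _).
rewrite sum_ffunE (bigD1 i) //= ffunE xpair_eqE eqxx big1 ?addr0 //.
by move=> i' /negPf i'i; rewrite ffunE xpair_eqE eq_sym i'i.
Qed.

(** A label selects one term of an affine form; [None] is the constant term, hence exponent 0. *)
Definition label_exponent (I : finType) (u : option I) : {ffun I -> nat} :=
  if u is Some i then [ffun j => (j == i) : nat] else 0.

Definition label_coef (I : finType) (R : comNzSemiRingType) (a0 : R) (a : I -> R)
  (u : option I) : R := if u is Some i then a i else a0.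

Lemma affineE (I : finType) (R : comNzSemiRingType) (a0 : R) (a : I -> R) :
  affine a0 a = \sum_u smono (label_coef a0 a u) (label_exponent u).
Proof.
rewrite (bigD1 None) //= (reindex_omap Some id) => [|[]] //=.
congr (_ + _); apply: eq_big => [i|i _]; first by rewrite eqxx.
by rewrite /sconst smonoM mulr1 add0r.
Qed.

(** Distributing the product of affine forms for each permutation leaves one monomial per labelled
    perfect matching. *)
Lemma scoef_perm_affine (I : finType) (R : comNzSemiRingType) (m : nat)
    (a0 : 'I_m * 'I_m -> R) (a : 'I_m * 'I_m -> I -> R) (e : {ffun I -> nat}) :
  scoef (ssubst (perm_poly R m) (fun j => affine (a0 j) (a j))) e =
  \sum_(s : 'S_m * {ffun 'I_m -> option I})
    if e == \sum_i label_exponent (s.2 i)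
    then \prod_i label_coef (a0 (i, s.1 i)) (a (i, s.1 i)) (s.2 i) else 0.
Proof.
rewrite ssubst_perm scoef_sum.
rewrite -(pair_bigA _ (fun (s : 'S_m) (c : {ffun 'I_m -> option I}) =>
  if e == \sum_i label_exponent (c i)
  then \prod_i label_coef (a0 (i, s i)) (a (i, s i)) (c i) else 0)).
apply: eq_bigr => s _ /=.
under eq_bigr => i _ do rewrite affineE.
rewrite bigA_distr_bigA scoef_sum; apply: eq_bigr => c _.
by rewrite smono_prod scoef_mono.
Qed.

(** * Cut monomials and the support of a projection *)

Definition cut_exponent (q n : nat) (A : {set 'I_n}) : {ffun offdiag n -> nat} :=
  [ffun ij => (((val ij).1 \in A) && ((val ij).2 \notin A)) * q.-1]%N.

(** Coefficients may exceed 1: the empty and the full set both give exponent 0. *)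
Lemma scoef_cut (R : comNzSemiRingType) (q n : nat) (e : {ffun offdiag n -> nat}) :
  scoef (cut_poly R q n) e = #|[set A | e == cut_exponent q A]|%:R.
Proof.
rewrite scoef_sum -sum1_card natr_sum [RHS]big_mkcond /=; apply: eq_bigr => A _.
under eq_bigr => ij _ do rewrite svarX.
rewrite smono_prod big1_eq scoef_mono inE; congr (if e == _ then _ else _).
apply/ffunP => ij; rewrite sum_ffunE !ffunE.
have [ijA|ijA] := boolP (_ && _).
  rewrite (bigD1 ij) //= ffunE eqxx big1 ?addr0 // => kl /andP[_ /negPf].
  by rewrite ffunE eq_sym => ->.
rewrite big1 // => kl klA; rewrite ffunE.
by case: eqP klA ijA => //= <- ->.
Qed.

(** The sums of ones stay above 1 if 0 <= 1 and below 1 if 1 <= 0; a vanishing one would force 1 = 0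
    either way. *)
Lemma ordered_natr_neq0 (R : comNzSemiRingType) (le : rel R) (n : nat) :
  semiring_order le -> n.+1%:R != 0 :> R.
Proof.
move=> hle; apply: contra_neq (oner_neq0 R) => n0.
apply: (sord_anti hle); case/orP: (sord_total hle 0 1) => h.
  by have := nonneg_nat_ge1 hle h (ltn0Sn n); rewrite n0 h => ->.
suff : le n.+1%:R 1 by rewrite n0 h => ->.
elim: {n0} n => [|n IH]; first exact: sord_refl.
apply: (sord_trans hle) IH.
by have := sord_add2r hle n.+1%:R h; rewrite add0r -mulrS.
Qed.

(** [S] holds the labelled edges with non-nilpotent coefficient. Non-negative terms cannot cancel,
    so the monomials of matchings inside [S] are exactly the cut monomials. *)
Lemma projection_support (R : comNzSemiRingType) (le : rel R) (q n m : nat) :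
  semiring_order le -> (2 <= q)%N -> (2 <= n)%N ->
  monotone_affine_projection le (cut_poly R q n) (perm_poly R m) ->
  exists S : 'I_m -> 'I_m -> option (offdiag n) -> Prop,
  [/\ (0 < m)%N,
      forall A : {set 'I_n}, exists (s : 'S_m) (c : {ffun 'I_m -> option (offdiag n)}),
        (forall i, S i (s i) (c i)) /\
        \sum_i label_exponent (c i) = cut_exponent q A
    & forall (s : 'S_m) (c : {ffun 'I_m -> option (offdiag n)}),
        (forall i, S i (s i) (c i)) ->
        exists A : {set 'I_n}, \sum_i label_exponent (c i) = cut_exponent q A].
Proof.
move=> hle q2 n2 [a0 [a [a0_ge0 a_ge0 fE]]].
pose lc i j u := label_coef (a0 (i, j)) (a (i, j)) u.
have lc_ge0 i j u : le 0 (lc i j u) by case: u => /=.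
pose F (e : {ffun offdiag n -> nat})
    (p : 'S_m * {ffun 'I_m -> option (offdiag n)}) : R :=
  if e == \sum_i label_exponent (p.2 i)
  then \prod_i lc i (p.1 i) (p.2 i) else 0.
have coefE e : #|[set A | e == cut_exponent q A]|%:R = \sum_p F e p.
  by rewrite -scoef_cut fE scoef_perm_affine.
have cardA (A : {set 'I_n}) :
    (0 < #|[set B | cut_exponent q A == cut_exponent q B]|)%N.
  by apply/card_gt0P; exists A; rewrite inE.
have [[s c] /=] : exists p, F (cut_exponent q [set Ordinal (ltnW n2)]) p != 0.
  apply: contrapT => /forallNP h.
  have /eqP := coefE (cut_exponent q [set Ordinal (ltnW n2)]).
  rewrite [X in _ == X]big1 => [|p _]; last by apply/eqP/negPn/negP/h.
  have := cardA [set Ordinal (ltnW n2)].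
  by case: #|_| => // k _; apply/negP; exact: (ordered_natr_neq0 _ hle).
rewrite /F /=; case: ifP => [/eqP e|]; last by rewrite eqxx.
move=> prod_neq0.
(* For m = 0 only exponent 0 arises, whereas the cut of {0} has exponent q-1 > 0 at (0, 1). *)
have m0 : (0 < m)%N.
  rewrite lt0n; apply/negP => /eqP m0; clear F coefE.
  subst m; move/ffunP: e.
  move=> /(_ (exist (fun ij : 'I_n * 'I_n => ij.1 != ij.2)
     (Ordinal (ltnW n2), Ordinal n2) isT)).
  by rewrite big_ord0 !ffunE /= !inE /=; lia.
(* If 1 <= 0, every non-negative x satisfies x <= 0 and so vanishes, but the product found above is
   nonzero. *)
have h01 : le 0 1.
  case/orP: (sord_total hle 0 1) => // h10; case/eqP: prod_neq0.
  rewrite (bigD1 (Ordinal m0)) //= [X in X * _](_ : _ = 0) ?mul0r //.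
  apply: (le_eq0 hle) => //; move: (lc _ _ _) (lc_ge0 (Ordinal m0)
    (s (Ordinal m0)) (c (Ordinal m0))) => x x0.
  by have := sord_mul2r hle h10 x0; rewrite mul1r mul0r.
have F_ge0 e' p : le 0 (F e' p).
  rewrite /F; case: ifP => _; last exact: sord_refl.
  by elim/big_ind: _ => // *; exact: (nonneg_mul hle).
exists (fun i j u => ~ nilpotent (lc i j u)); split => // [A|s' c' Ssc].
  have : ~ nilpotent (\sum_p F (cut_exponent q A) p).
    by rewrite -coefE; apply: (not_nilpotent_ge1 hle h01); exact: nonneg_nat_ge1.
  move=> /(sum_not_nilpotent hle h01 (F_ge0 _))[[s' c']].
  rewrite /F /=; case: ifP => [/eqP e' nF|_ []]; last by exists 1%N.
  exists s', c'; split => // i nil_i; apply: nF.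
  by rewrite (bigD1 i) //=; exact: nilpotentMr.
apply: contrapT => /forallNP nA.
have := coefE (\sum_i label_exponent (c' i)).
rewrite (_ : [set A | _] = set0); last first.
  by apply/setP => A; rewrite !inE; apply/eqP; exact: nA.
rewrite cards0 => /esym/(nonneg_sum_eq0 hle (F_ge0 _))/(_ (s', c')).
rewrite /F /= eqxx => p0.
apply: (prod_not_nilpotent hle h01 (fun i => lc_ge0 i (s' i) (c' i)) Ssc).
by exists 1%N.
Qed.

(** * The cut functional *)

Section CutFunctional.
Context (n : nat) (b : bitseq).

Let bit (i : nat) : int := (nth false b i : nat)%:Z.
Let beta : int := \sum_(i < n) bit i.

(** Vertex [ord0] is a root added to the n bits. With k the size of the intersection of A and b, a
    cut of A gets q-1 times k(2-k) if A avoids the root and -(beta-k)^2 otherwise. *)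
Definition cut_weight (ij : 'I_n.+1 * 'I_n.+1) : int :=
  match unlift ord0 ij.1, unlift ord0 ij.2 with
  | None, None => 0
  | None, Some j => - beta * bit j
  | Some i, None => (2 - beta) * bit i
  | Some i, Some j => bit i * bit j
  end.

Definition cut_functional (e : {ffun offdiag n.+1 -> nat}) : int :=
  \sum_ij (e ij)%:Z * cut_weight (val ij).

Lemma cut_functional_sum (J : finType) (e : J -> {ffun offdiag n.+1 -> nat}) :
  cut_functional (\sum_j e j) = \sum_j cut_functional (e j).
Proof.
rewrite exchange_big; apply: eq_bigr => ij _ /=.
by rewrite sum_ffunE (big_morph Posz PoszD (erefl : Posz 0 = 0)) mulr_suml.
Qed.

Lemma cut_functionalE (q : nat) (A : {set 'I_n.+1}) :
  let x : int := (ord0 \in A : nat)%:Z in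
  let k := \sum_(i < n) (lift ord0 i \in A : nat)%:Z * bit i in
  cut_functional (cut_exponent q A) = q.-1%:Z *
    ((1 - x) * k * (2 - beta) + k * (beta - k) - x * beta * (beta - k)).
Proof.
move=> x k.
pose y (i : 'I_n.+1) : int := (i \in A : nat)%:Z.
have bit2 i : bit i * bit i = bit i by rewrite /bit; case: nth.
have -> : cut_functional (cut_exponent q A) =
    q.-1%:Z * \sum_i \sum_j y i * (1 - y j) * cut_weight (i, j).
  rewrite pair_bigA mulr_sumr /=.
  (* Diagonal pairs contribute y j (1 - y j) = 0, so the sum may run over all pairs. *)
  rewrite (bigID (fun ij : 'I_n.+1 * 'I_n.+1 => ij.1 != ij.2)) /=.
  rewrite [X in _ + X]big1 ?addr0; last first.
    move=> [i j] /= /negPn/eqP ->; rewrite /y; case: (j \in A) => /=;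
      by rewrite ?subrr ?mulr0 ?mul0r ?mulr0.
  rewrite (reindex_omap (fun ij : offdiag n.+1 => val ij) insub) /=; last first.
    by move=> ij h; rewrite insubT.
  rewrite /cut_functional; apply: eq_big => [ij|ij _].
    by rewrite valK eqxx andbT (valP ij).
  rewrite ffunE -surjective_pairing /y.
  by case: (_ \in A) => /=; case: (_ \in A) => /=; ring.
rewrite big_ord_recl; congr (_ * _).
have bk : beta - k = \sum_(j < n) (1 - y (lift ord0 j)) * bit j.
  by rewrite /beta /k -sumrB; apply: eq_bigr => j _; rewrite /y; ring.
have e1 : \sum_j y ord0 * (1 - y j) * cut_weight (ord0, j) =
    - x * beta * (beta - k).
  rewrite big_ord_recl /cut_weight /= unlift_none mulr0 add0r.
  rewrite bk mulr_sumr /=; apply: eq_bigr => j _.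
  by rewrite liftK /y -/x; ring.
have e2 (i : 'I_n) :
    \sum_j y (lift ord0 i) * (1 - y j) * cut_weight (lift ord0 i, j) =
    y (lift ord0 i) * bit i * ((1 - x) * (2 - beta) + (beta - k)).
  rewrite big_ord_recl /cut_weight /= unlift_none liftK -/x.
  rewrite [RHS]mulrDr bk mulr_sumr /=; congr (_ + _).
    by rewrite /y -/x; ring.
  by apply: eq_bigr => j _; rewrite liftK /y; ring.
rewrite e1 (eq_bigr _ (fun i _ => e2 i)) -mulr_suml -/k; ring.
Qed.

Lemma cut_functional_le (q : nat) (A : {set 'I_n.+1}) :
  cut_functional (cut_exponent q A) <= q.-1%:Z.
Proof.
rewrite cut_functionalE; set k := \sum_(i < n) _.
rewrite -[leRHS]mulr1 ler_wpM2l //; case: (ord0 \in A) => /=.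
  by have := sqr_ge0 (beta - k); nia.
by have := sqr_ge0 (k - 1); nia.
Qed.

(** The prepended [false] keeps the root outside the set. *)
Definition bits_set (a : bitseq) : {set 'I_n.+1} :=
  [set i : 'I_n.+1 | nth false (false :: a) i].

Lemma cut_functional_bits (q : nat) (a : bitseq) :
  let k : int := (isect n a b)%:Z in
  cut_functional (cut_exponent q (bits_set a)) = q.-1%:Z * (k * (2 - k)).
Proof.
move=> k; rewrite cut_functionalE inE /=.
have -> : \sum_(i < n) (lift ord0 i \in bits_set a : nat)%:Z * bit i = k.
  rewrite /k /isect (big_morph Posz PoszD (erefl : Posz 0 = 0)).
  apply: eq_bigr => i _; rewrite inE /= /bit.
  by case: (nth false a i) => /=; case: (nth false b i).
by congr (_ * _); ring.
Qed.

End CutFunctional.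

(** * The lower bound for the permanent *)

Lemma card_offdiag (n : nat) : (#|{: option (offdiag n.+1)}| <= n.+1 * n.+1)%N.
Proof.
rewrite card_option card_sig -[X in (_ < X * X)%N](card_ord n.+1) -card_prod.
apply: proper_card; apply/properP; split; first exact: subset_predT.
by exists (ord0, ord0).
Qed.

(* For each edge e, the sets whose chosen matching contains e and the b such
   that no chosen matching of a set meeting b exactly once contains e form a
   rectangle.  If a set disjoint from b were in none of them, every edge of its
   matching would lie in a matching optimal for [cut_functional _ b]; taking it
   away from the union of those m optimal matchings leaves an (m-1)-regular
   multigraph that is too heavy. *)
Lemma projection_lower_bound (R : comNzSemiRingType) (le : rel R) (q n m : nat) :
  semiring_order le -> (2 <= q)%N -> (2 <= n)%N ->
  monotone_affine_projection le (cut_poly R q n) (perm_poly R m) ->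
  (3 ^ n.-1 <= m * m * (n * n) * 2 ^ n.-1)%N.
Proof.
move=> hle q2; case: n => // n n2 /(projection_support hle q2 n2).
move=> [S [m0 Sex Scut]] /=.
have ex (a : bitseq) : exists p : 'S_m * {ffun 'I_m -> option (offdiag n.+1)},
    (forall i, S i (p.1 i) (p.2 i)) /\
    \sum_i label_exponent (p.2 i) = cut_exponent q (bits_set n a).
  by have [s [c sc]] := Sex (bits_set n a); exists (s, c).
have [sc scP] := choice ex.
pose edg (e : 'I_m * 'I_m * option (offdiag n.+1)) (a : bitseq) : bool :=
  edge (sc a).1 (sc a).2 e.1.1 e.1.2 e.2.
pose Q e b := `[< forall a, isect n a b = 1%N -> ~~ edg e a >].
apply: (@leq_trans (#|{: 'I_m * 'I_m * option (offdiag n.+1)}| * 2 ^ n)); last first.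
  by rewrite leq_mul2r !card_prod !card_ord leq_mul2l card_offdiag !orbT.
apply: (@rectangle_cover n _ edg Q) => [e a b ea /asboolP Qb|a b ab0].
  by apply/eqP => /Qb; rewrite ea.
apply: contrapT => ncov.
pose w (u : option (offdiag n.+1)) : int := @cut_functional n b (label_exponent u).
(* As (a, b) is uncovered, each edge of the matching of a also lies in that of some a' meeting b
   exactly once. *)
have exg i : exists a', isect n a' b = 1%N /\ edg (i, (sc a).1 i, (sc a).2 i) a'.
  apply: contrapT => /forallNP ng; apply: ncov.
  exists (i, (sc a).1 i, (sc a).2 i); first by rewrite /edg /edge !eqxx.
  by apply/asboolP => a' a'b; apply/negP => ea'; apply: (ng a').
have [g gP] := choice exg.
have wsc a' : \sum_i w ((sc a').2 i) = cut_functional b (cut_exponent q (bits_set n a')).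
  by rewrite -(scP a').2 cut_functional_sum.
(* The union with multiplicity of these m matchings is m-regular and contains the matching of a. *)
pose G i j u := (\sum_t edg (i, j, u) (g t))%N.
have leG i j u : (edg (i, j, u) a <= G i j u)%N.
  case: (boolP (edg _ a)) => // /andP[/= /eqP -> /eqP ->].
  by rewrite /G (bigD1 i) //= (gP i).2.
have := @regular_weight _ _ m.-1 (fun i j u => G i j u - edg (i, j, u) a)%N
  w q.-1%:Z.
have GE i j u : (G i j u - edg (i, j, u) a + edg (i, j, u) a = G i j u)%N.
  by rewrite subnK.
have rowE a' i : (\sum_j \sum_u edg (i, j, u) a' = 1)%N by exact: edge_row.
have colE a' j : (\sum_i \sum_u edg (i, j, u) a' = 1)%N by exact: edge_col.
(* The matching of a weighs 0, so removing it keeps the whole weight m(q-1), above the bound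
   (m-1)(q-1) of [regular_weight]. *)
suff hD : \sum_i \sum_j \sum_u (G i j u - edg (i, j, u) a)%N%:Z * w u = m%:Z * q.-1%:Z.
  rewrite hD => h; have : m%:Z * q.-1%:Z <= m.-1%:Z * q.-1%:Z :> int; last by nia.
  apply: h => [i|j|s c sD].
  - apply: (@addIn (\sum_j \sum_u edg (i, j, u) a)%N).
    rewrite [in RHS]rowE addn1 prednK // -big_split /=.
    under eq_bigr => j _.
      by rewrite -big_split /=; under eq_bigr => u _ do rewrite GE;
        rewrite exchange_big; over.
    rewrite exchange_big /=; under eq_bigr => t _ do rewrite rowE.
    by rewrite sum1_card card_ord.
  - apply: (@addIn (\sum_i \sum_u edg (i, j, u) a)%N).
    rewrite [in RHS]colE addn1 prednK // -big_split /=.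
    under eq_bigr => i _.
      by rewrite -big_split /=; under eq_bigr => u _ do rewrite GE;
        rewrite exchange_big; over.
    rewrite exchange_big /=; under eq_bigr => t _ do rewrite colE.
    by rewrite sum1_card card_ord.
  (* A matching within the remaining edges still lies in [S], so its monomial is a cut and weighs at
     most q-1. *)
  have [|A eA] := Scut s c.
    move=> i; have : (0 < G i (s i) (c i))%N by apply: leq_trans (sD i) (leq_subr _ _).
    rewrite lt0n sum_nat_eq0 => /forallPn[t]; rewrite /= eqb0 negbK.
    by move=> /andP[/= /eqP -> /eqP ->]; exact: (scP (g t)).1.
  by rewrite -cut_functional_sum eA cut_functional_le.
transitivity (\sum_i \sum_j \sum_u (G i j u)%:Z * w u - \sum_i w ((sc a).2 i)).
  rewrite -(edge_weight (sc a).1) -sumrB; apply: eq_bigr => i _.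
  rewrite -sumrB; apply: eq_bigr => j _; rewrite -sumrB; apply: eq_bigr => u _.
  by rewrite -mulrBl subzn; last exact: leG.
rewrite wsc cut_functional_bits ab0 mul0r mulr0 subr0.
transitivity (\sum_t \sum_i w ((sc (g t)).2 i)); last first.
  under eq_bigr => t _ do rewrite wsc cut_functional_bits (gP t).1 mulr1.
  by rewrite sumr_const card_ord -mulr_natl natz.
under [RHS]eq_bigr => t _ do rewrite -(edge_weight (sc (g t)).1).
rewrite [RHS]exchange_big; apply: eq_bigr => i _.
rewrite [RHS]exchange_big; apply: eq_bigr => j _.
rewrite [RHS]exchange_big; apply: eq_bigr => u _.
by rewrite /G (big_morph Posz PoszD (erefl : Posz 0 = 0)) mulr_suml.
Qed.

Theorem theorem4p4 (K : realType) (R : comNzSemiRingType) (le : rel R)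
    (hle : semiring_order le) (q : nat) (hq : (2 <= q)%N) :
  (exists2 eps : K, 0 < eps &
     exists n0 : nat, forall n : nat, (n0 <= n)%N ->
       forall m : nat,
         monotone_affine_projection le (cut_poly R q n) (perm_poly R m) ->
         2 `^ (eps * n%:R) <= m%:R)
  /\ ~ monotone_affine_p_projection le
         (fun n : nat => cut_poly R q n) (fun m : nat => perm_poly R m).
Proof.
have bound n m : (34 <= n)%N ->
    monotone_affine_projection le (cut_poly R q n) (perm_poly R m) ->
    (2 ^ n <= m ^ 16)%N.
  move=> n34 proj; apply: exp2_le_of_cover => //.
  apply: projection_lower_bound hle hq _ proj; exact: leq_trans n34.
split.
  (* The exponent 1/16 is read off from [bound], after both sides are raised to the 16th power. *)
  exists 16^-1; first by rewrite invr_gt0.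
  exists 34%N => n n34 m /(bound _ _ n34) nm.
  rewrite -(@ler_pXn2r _ 16) // ?nnegrE ?powR_ge0 //.
  rewrite -powR_mulrn ?powR_ge0 // -powRrM mulrAC mulVf ?pnatr_eq0 // mul1r.
  by rewrite powR_mulrn // -!natrX ler_nat.
move=> [p [c pc] [n0 hp]].
have [n nN lt] := polynomially_bounded_lt_exp c (maxn 34 n0).
move: nN; rewrite geq_max => /andP[n34 /hp /(bound _ _ n34)].
apply/negP; rewrite -ltnNge; apply: leq_ltn_trans lt.
by rewrite leq_exp2r.
Qed.
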